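(* For every positive integer $n$ and all (positive) partitions $\lambda\supset\mu$, the skew spin $q$-Whittaker polynomials $\mathbb{F}_{\lambda/\mu}(x_1,\dots,x_n)$ and the dual skew spin $q$-Whittaker polynomials $\mathbb{F}^*_{\lambda/\mu}(x_1,\dots,x_n)$ are symmetric in their variables $x_1,\dots,x_n$.
   Context: Fix $q,s\in\mathbb{C}$ with $|q|<1$, $|s|<1$. Write $(a;q)_m=\prod_{i=1}^m(1-aq^{i-1})$ for $m\ge 1$, $(a;q)_0=1$, $(a;q)_\infty=\prod_{i\ge1}(1-aq^{i-1})$. A (positive) partition is a finite, possibly empty, sequence $\lambda_1\ge\dots\ge\lambda_\ell\ge1$ of integers; $\ell(\lambda)=\ell$; $\lambda_i:=0$ for $i>\ell(\lambda)$. $\lambda\supset\mu$ means $\ell(\lambda)\ge\ell(\mu)$ and $\lambda_i\ge\mu_i$ for all $1\le i\le\ell(\mu)$. Vertex weights: for $x\in\mathbb{C}$ and $i,j,k,\ell\in\mathbb{Z}_{\ge0}$, $$W_x(i,j;k,\ell)=\mathbf 1_{i+j=k+\ell}\,\mathbf 1_{i\ge\ell}\;x^\ell\frac{(-s/x;q)_\ell\,(-sx;q)_{i-\ell}\,(q;q)_k}{(q;q)_\ell\,(q;q)_{i-\ell}\,(s^2;q)_k},$$ where $x^\ell(-s/x;q)_\ell$ is read as the polynomial $\prod_{r=0}^{\ell-1}(x+sq^r)$. ($i,j,k,\ell$ are the numbers of paths on the bottom, left, top, right edges of the vertex.) Skew spin $q$-Whittaker polynomial: for partitions $\lambda,\mu$,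 $$\mathbb{F}_{\lambda/\mu}(x_1,\dots,x_n)=\sum\prod_{r=1}^n\left[x_r^{h_{r,0}}\frac{(-s/x_r;q)_{h_{r,0}}}{(q;q)_{h_{r,0}}}\prod_{c\ge1}W_{x_r}\big(v_{r-1,c},h_{r,c-1};v_{r,c},h_{r,c}\big)\right],$$ the sum running over all non-negative integers $h_{r,c}$ ($1\le r\le n$, $c\ge0$), with $h_{r,c}=0$ for all large $c$, and $v_{r,c}$ ($0\le r\le n$, $c\ge1$) subject to $v_{0,c}=\mu_c-\mu_{c+1}$ and $v_{n,c}=\lambda_c-\lambda_{c+1}$; all but finitely many vertex weights equal $W_x(0,0;0,0)=1$ in any nonzero term. (Equivalently: the partition function on columns $0,1,2,\dots$ and rows $1,\dots,n$ numbered from bottom to top, row $r$ carrying $x_r$, all left and right boundary edges empty, infinitely many paths in column $0$ with weights $W_x(\infty,0;\infty,\ell)=x^\ell\frac{(-s/x;q)_\ell(-sx;q)_\infty}{(q;q)_\ell(s^2;q)_\infty}$, divided by $\prod_{i=1}^n(-sx_i;q)_\infty/(s^2;q)_\infty$.) Dual polynomials: $$\mathbb{F}^*_{\lambda/\mu}(x_1,\dots,x_n)=\frac{\tilde c_{\lambda'}}{\tilde c_{\mu'}}\,\mathbb{F}_{\lambda/\mu}(x_1,\dots,x_n),\qquad \tilde c_{\lambda'}=\prod_{i\ge1}\frac{(s^2;q)_{\lambda_i-\lambda_{i+1}}}{(q;q)_{\lambda_i-\lambda_{i+1}}}.$$ *)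

(* Defs.v *)
From mathcomp Require Import all_boot all_order all_algebra all_fingroup.
From mathcomp Require Import boolp classical_sets cardinality fsbigop reals.
From mathcomp Require Import complex.

Set Implicit Arguments.
Unset Strict Implicit.
Unset Printing Implicit Defensive.

Import Order.TTheory GRing.Theory Num.Theory.
Local Open Scope ring_scope.

Definition is_partition (la : seq nat) : bool :=
  sorted geq la && all (leq 1) la.

(* Parts are numbered from 0: [part la i] is $\lambda_{i+1}$, which is 0 beyond
   the length of [la]. *)
Definition part (la : seq nat) (i : nat) : nat := nth 0%N la i.

Definition part_contains (la mu : seq nat) : Prop :=
  (size mu <= size la)%N /\
  forall i : nat, (i < size mu)%N -> (part mu i <= part la i)%N.

(* $\lambda_{i+1} - \lambda_{i+2}$; the truncated subtraction is exact on
   partitions. *)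
Definition part_mult (la : seq nat) (i : nat) : nat :=
  (part la i - part la i.+1)%N.

Section Weights.

Variables (K : fieldType) (q s : K).

Definition qpoch (a : K) (m : nat) : K := \prod_(i < m) (1 - a * q ^+ i).

(* The polynomial $x^l (-s/x; q)_l$, which also makes sense at $x = 0$. *)
Definition xqpoch (x : K) (l : nat) : K := \prod_(r < l) (x + s * q ^+ r).

(* The four edges i, j, k, l are bottom, left, top, right. *)
Definition vertex_weight (x : K) (i j k l : nat) : K :=
  if (i + j == k + l)%N && (l <= i)%N then
    xqpoch x l * qpoch (- (s * x)) (i - l) * qpoch q k
    / (qpoch q l * qpoch q (i - l) * qpoch (s ^+ 2) k)
  else 0.

Definition left_weight (x : K) (l : nat) : K := xqpoch x l / qpoch q l.

(* A configuration is a pair [(h, v)]. Rows are numbered from 0, so that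
   [h r c] is $h_{r+1,c}$ for every $c \ge 0$. As $v_{r,c}$ only exists for
   $c \ge 1$, [v r c] is $v_{r,c+1}$, with $r$ ranging over $0, \dots, n$. *)
Definition config (n : nat) : Type :=
  (('I_n -> nat -> nat) * ('I_n.+1 -> nat -> nat))%type.

(* Finite support is also required of [v]: since [h r] vanishes in all far
   columns and [v ord0] does too, any other [v] breaks path conservation at some
   vertex and so has weight 0. With this condition the product over all columns
   in [config_weight] has finitely many factors different from 1; without it,
   the iterated product would default to 1 on some of these terms. *)
Definition admissible (n : nat) (la mu : seq nat) : set (config n) :=
  [set hv : config n |
    [/\ exists N : nat, forall (r : 'I_n) (c : nat), (N <= c)%N -> hv.1 r c = 0%N,
        exists N : nat, forall (r : 'I_n.+1) (c : nat), (N <= c)%N -> hv.2 r c = 0%N,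
        forall c : nat, hv.2 ord0 c = part_mult mu c
      & forall c : nat, hv.2 ord_max c = part_mult la c]].

(* For [r : 'I_n], [widen_ord (leqnSn n) r] and [lift ord0 r] are [r] and [r + 1]
   in ['I_n.+1]: the vertical edges below and above that row. *)
Definition config_weight (n : nat) (x : 'I_n -> K) (hv : config n) : K :=
  \prod_(r < n)
    (left_weight (x r) (hv.1 r 0%N) *
     \big[*%R/1]_(c \in [set: nat])
       vertex_weight (x r) (hv.2 (widen_ord (leqnSn n) r) c) (hv.1 r c)
                           (hv.2 (lift ord0 r) c) (hv.1 r c.+1)).

(* The set of configurations is infinite, but only finitely many terms are
   nonzero: in a nonzero term paths never move left or disappear, so that every
   edge carries at most $\lambda_1$ paths and all edges to the right of column
   $\ell(\lambda)$ are empty. *)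
Definition spin_qWhittaker (n : nat) (la mu : seq nat) (x : 'I_n -> K) : K :=
  \sum_(hv \in @admissible n la mu) config_weight x hv.

(* $\tilde c_{\lambda'}$, as a function of $\lambda$; the factors with
   $i > \ell(\lambda)$ are 1. *)
Definition ctilde (la : seq nat) : K :=
  \prod_(i < size la)
    (qpoch (s ^+ 2) (part_mult la i) / qpoch q (part_mult la i)).

Definition dual_spin_qWhittaker (n : nat) (la mu : seq nat) (x : 'I_n -> K) : K :=
  ctilde la / ctilde mu * spin_qWhittaker la mu x.

End Weights.

Definition symmetric_fun (K : Type) (n : nat) (f : ('I_n -> K) -> K) : Prop :=
  forall (sigma : 'S_n) (x : 'I_n -> K), f (fun i => x (sigma i)) = f x.

(* Main.v *)
(** Adding a row with variable [x] is a transfer operator [T(x)] on path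
    occupations of the columns, and symmetry amounts to [T(x) T(y) = T(y) T(x)].
    Let [L(u)] be the transfer operator of the six-vertex-type model in which
    horizontal edges carry at most one path. The [L(u)] commute, by a local
    exchange relation pushed through the columns. Fusion gives
    [T(q x) = L(-x) T(x)], and [T(-s)] is the identity, so for [q, s <> 0] each
    [T(-s q^J)] is a product of commuting operators [L(u)]. Matrix entries of
    the commutator of [T(x)] and [T(y)] are polynomial in [x] and [y], hence
    vanish identically; they are rational in [s] and [q] without poles in the
    unit disc, which settles [s = 0] and [q = 0]. *)

Require Import Defs.
From mathcomp Require Import all_boot all_order all_algebra all_fingroup.
From mathcomp Require Import boolp classical_sets cardinality fsbigop reals.
From mathcomp Require Import complex ring zify.

Set Implicit Arguments.
Unset Strict Implicit.
Unset Printing Implicit Defensive.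

Import Order.TTheory GRing.Theory Num.Theory.
Local Open Scope ring_scope.

(** * One-row and two-row partition functions *)

Lemma big_ord_only (V : nmodType) (N a : nat) (f : nat -> V) :
  (forall l, l != a -> f l = 0) -> ((N <= a)%N -> f a = 0) ->
  \sum_(l < N) f l = f a.
Proof.
move=> f0 fN; case: (ltnP a N) => [ltaN|leNa].
  rewrite (bigD1 (Ordinal ltaN)) //= big1 ?addr0 // => l /eqP nla.
  by apply: f0; apply/eqP => la; apply: nla; apply: val_inj.
rewrite fN // big1 // => l _; apply: f0.
by have := ltn_ord l; apply: contraTneq => ->; rewrite -leqNgt.
Qed.

Lemma big_ord01 (V : nmodType) (N : nat) (f : nat -> V) : (1 < N)%N ->
  (forall l, (1 < l)%N -> f l = 0) -> \sum_(l < N) f l = f 0%N + f 1%N.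
Proof.
case: N => [|[|N]] // _ f0; rewrite !big_ord_recl big1 ?addr0 // => l _.
exact: f0.
Qed.

Section Transfer.

Variables (K : fieldType) (N : nat).
Implicit Types (w : nat -> nat -> nat -> nat -> K) (bs ts : seq nat).

Definition conserving w :=
  forall i j k l, (i + j)%N != (k + l)%N -> w i j k l = 0.

(** [j] paths enter from the left and none leaves on the right. For conserving weights the cut-off
    [N] has no effect once the top carries fewer than [N] paths. *)
Fixpoint row_pf w (j : nat) bs ts : K :=
  match bs, ts with
  | [::], [::] => (j == 0%N)%:R
  | i :: bs', k :: ts' => \sum_(l < N) w i j k l * row_pf w l bs' ts'
  | _, _ => 0
  end.

(** [w1] is the lower row and [m] the edge between the rows. Both rows advance together, so that
    local relations can be pushed through the columns. *)
Fixpoint row2_pf w1 w2 (j1 j2 : nat) bs ts : K :=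
  match bs, ts with
  | [::], [::] => ((j1 == 0%N) && (j2 == 0%N))%:R
  | i :: bs', k :: ts' =>
      \sum_(l1 < N) \sum_(l2 < N) \sum_(m < N)
        w1 i j1 m l1 * w2 m j2 k l2 * row2_pf w1 w2 l1 l2 bs' ts'
  | _, _ => 0
  end.

Lemma row_pf_eq0 w j bs ts : conserving w ->
  (j + sumn bs)%N != sumn ts -> row_pf w j bs ts = 0.
Proof.
move=> cw; elim: bs j ts => [|i bs IH] j [|k ts] //= ne.
  by rewrite addn0 in ne; rewrite (negPf ne).
rewrite big1 // => l _.
have [e|/cw->] := eqVneq (i + j)%N (k + l)%N; last by rewrite mul0r.
by rewrite IH ?mulr0 //; lia.
Qed.

Lemma row2_pf_eq0 w1 w2 j1 j2 bs ts : conserving w1 -> conserving w2 ->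
  (j1 + j2 + sumn bs)%N != sumn ts -> row2_pf w1 w2 j1 j2 bs ts = 0.
Proof.
move=> c1 c2; elim: bs j1 j2 ts => [|i bs IH] j1 j2 [|k ts] //= ne.
  by rewrite addn0 addn_eq0 in ne; rewrite (negPf ne).
rewrite big1 // => l1 _; rewrite big1 // => l2 _; rewrite big1 // => m _.
have [e|/c1->] := eqVneq (i + j1)%N (m + l1)%N; last by rewrite !mul0r.
have [e'|/c2->] := eqVneq (m + j2)%N (k + l2)%N; last by rewrite mulr0 mul0r.
by rewrite IH ?mulr0 //; lia.
Qed.

(** Conservation leaves a single right edge. If [i + j < k] the subtraction truncates, but then the
    weight is zero; if the edge reaches [N], the rest of the row is zero. *)
Lemma row_pf_cons w j i bs k ts : conserving w -> (k + sumn ts < N)%N ->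
  row_pf w j (i :: bs) (k :: ts) =
    w i j k (i + j - k)%N * row_pf w (i + j - k) bs ts.
Proof.
move=> cw ltN /=.
apply: (big_ord_only (f := fun l => w i j k l * row_pf w l bs ts)) => [l ne|le].
  by rewrite cw ?mul0r //; lia.
by rewrite row_pf_eq0 ?mulr0 //; lia.
Qed.

Lemma row2_pf_cons w1 w2 j1 j2 i bs k ts :
  conserving w1 -> conserving w2 -> (k + sumn ts < N)%N ->
  row2_pf w1 w2 j1 j2 (i :: bs) (k :: ts) =
    \sum_(l < N) w1 i j1 (k + l - j2)%N (i + j1 + j2 - k - l)%N *
      w2 (k + l - j2)%N j2 k l * row2_pf w1 w2 (i + j1 + j2 - k - l) l bs ts.
Proof.
move=> c1 c2 ltN /=; rewrite exchange_big /=; apply: eq_bigr => l _.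
set l1 := (i + j1 + j2 - k - l)%N; set m := (k + l - j2)%N.
rewrite (big_ord_only (a := l1) (f := fun l1 => \sum_(m < N)
   w1 i j1 m l1 * w2 m j2 k l * row2_pf w1 w2 l1 l bs ts)).
- apply: (big_ord_only (f := fun m =>
     w1 i j1 m l1 * w2 m j2 k l * row2_pf w1 w2 l1 l bs ts)) => [m' ne|le].
    by rewrite [w2 _ _ _ _]c2 ?mulr0 ?mul0r //; lia.
  by rewrite row2_pf_eq0 ?mulr0 //; lia.
- move=> l1' ne; rewrite big1 // => m' _.
  have [e|/c1->] := eqVneq (i + j1)%N (m' + l1')%N; last by rewrite !mul0r.
  by rewrite c2 ?mulr0 ?mul0r //; lia.
- by move=> le; rewrite big1 // => m' _; rewrite row2_pf_eq0 ?mulr0 //; lia.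
Qed.

Lemma row2_pf_cons01 w1 w2 j1 j2 i bs k ts :
  conserving w1 -> conserving w2 ->
  (forall i j k l, (1 < l)%N -> w2 i j k l = 0) ->
  (1 < N)%N -> (k + sumn ts < N)%N ->
  row2_pf w1 w2 j1 j2 (i :: bs) (k :: ts) =
    w1 i j1 (k - j2)%N (i + j1 + j2 - k)%N * w2 (k - j2)%N j2 k 0%N *
      row2_pf w1 w2 (i + j1 + j2 - k) 0 bs ts +
    w1 i j1 (k.+1 - j2)%N (i + j1 + j2 - k.+1)%N * w2 (k.+1 - j2)%N j2 k 1%N *
      row2_pf w1 w2 (i + j1 + j2 - k.+1) 1 bs ts.
Proof.
move=> c1 c2 w01 N2 ltN; rewrite row2_pf_cons //.
rewrite (big_ord01 (f := fun l => w1 i j1 (k + l - j2)%N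
  (i + j1 + j2 - k - l)%N * w2 (k + l - j2)%N j2 k l *
  row2_pf w1 w2 (i + j1 + j2 - k - l) l bs ts)) //.
  by rewrite !addn0 !subn0 addn1 -subnDA addn1.
by move=> l l1; rewrite w01 // mulr0 mul0r.
Qed.

End Transfer.

(** Certifies an identity modulo two linear relations: once [a] and [b] are given, only a goal for
    [ring] remains. *)
Lemma eq_comb2 (K : comPzRingType) (a b x1 y1 x2 y2 x y : K) :
  x1 = y1 -> x2 = y2 -> x - y = a * (x1 - y1) + b * (x2 - y2) -> x = y.
Proof. by move=> -> ->; rewrite !subrr !mulr0 addr0 => /subr0_eq. Qed.

(** * Six-vertex exchange relation *)

Section SixVertex.

Variables (K : fieldType) (q s : K).

(* Higher-spin six-vertex weights. At [u = s] they agree with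
   [vertex_weight q s (- s * q)] on horizontal edges with at most one path. *)
Definition six_vertex (u : K) (i j k l : nat) : K :=
  if (i + j == k + l)%N then
    match j, l with
    | 0, 0 => 1 - s * u * q ^+ i
    | 0, 1 => u * (1 - s ^+ 2 * q ^+ k)
    | 1, 0 => 1 - q ^+ k
    | 1, 1 => u - s * q ^+ i
    | _, _ => 0
    end / (1 - s * u)
  else 0.

Lemma six_vertex_conserving u : conserving (six_vertex u).
Proof. by rewrite /six_vertex => i j k l /negPf->. Qed.

Lemma six_vertex_right u i j k l : (1 < l)%N -> six_vertex u i j k l = 0.
Proof.
rewrite /six_vertex.
by case: l j => [|[|l]] // [|[|j]] _; rewrite mul0r if_same.
Qed.

Lemma vertex_weight_conserving x : conserving (vertex_weight q s x).
Proof. by rewrite /vertex_weight => i j k l /negPf->. Qed.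

Variable N : nat.
Hypothesis N2 : (1 < N)%N.

(** Each six-vertex row changes the occupation of a column by at most one, hence two rows by at most
    two. *)
Lemma row2_six_vertex_eq0 u v j1 j2 i bs k ts :
  (j1 <= 1)%N -> (j2 <= 1)%N -> (k + sumn ts < N)%N ->
  (i.+2 < k)%N || (k.+2 < i)%N ->
  row2_pf N (six_vertex u) (six_vertex v) j1 j2 (i :: bs) (k :: ts) = 0.
Proof.
move=> j11 j21 ltN ik; rewrite row2_pf_cons01 //; last first.
- exact: six_vertex_right.
- exact: six_vertex_conserving.
- exact: six_vertex_conserving.
have E m l : (i.+2 < m.+1)%N || (1 < l)%N -> six_vertex u i j1 m l = 0.
  case/orP=> H; last exact: six_vertex_right.
  by apply: six_vertex_conserving; lia.
by rewrite !E ?mul0r ?addr0 //; lia.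
Qed.

(* The last two combinations span the part of the exchange relation with one
   incoming path; the induction over columns needs both, the left boundary
   only the first. *)
Lemma six_vertex_exchange u v : s * u != 1 -> s * v != 1 ->
  forall bs ts, (sumn ts < N)%N ->
  let Z := row2_pf N (six_vertex u) (six_vertex v) in
  let Z' := row2_pf N (six_vertex v) (six_vertex u) in
  [/\ Z 0%N 0%N bs ts = Z' 0%N 0%N bs ts,
      Z 1%N 1%N bs ts = Z' 1%N 1%N bs ts,
      u * Z 1%N 0%N bs ts + v * Z 0%N 1%N bs ts =
        v * Z' 1%N 0%N bs ts + u * Z' 0%N 1%N bs ts
    & Z 1%N 0%N bs ts + q * Z 0%N 1%N bs ts =
        Z' 1%N 0%N bs ts + q * Z' 0%N 1%N bs ts].
Proof.
move=> su sv; elim=> [|i bs IH] [|k ts] ltN Z Z'; rewrite /Z /Z'.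
- by rewrite /= !mulr0.
- by rewrite /= !mulr0.
- by rewrite /= !mulr0.
have [|H00 H11 H1 H2] := IH ts; first by rewrite /= in ltN; lia.
rewrite [sumn _]/= in ltN.
have du : 1 - s * u != 0 by rewrite subr_eq0 eq_sym.
have dv : 1 - s * v != 0 by rewrite subr_eq0 eq_sym.
have cu := six_vertex_conserving u; have cv := six_vertex_conserving v.
have ru := @six_vertex_right u; have rv := @six_vertex_right v.
have [out|ik] := boolP ((i.+2 < k)%N || (k.+2 < i)%N).
  by rewrite !row2_six_vertex_eq0 // !mulr0 addr0.
rewrite !(@row2_pf_cons01 _ N (six_vertex u) (six_vertex v)) //.
rewrite !(@row2_pf_cons01 _ N (six_vertex v) (six_vertex u)) //.
(* From here on the remaining columns enter only through the four relations of the induction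
   hypothesis. *)
move: (row2_pf N (six_vertex u) (six_vertex v)) H00 H11 H1 H2 => {Z} Z.
move: (row2_pf N (six_vertex v) (six_vertex u)) => {Z'} Z' H00 H11 H1 H2.
clear cu cv ru rv IH N2 ltN; rewrite /six_vertex.
have neq1 n : (n == n.+1)%N = false by apply/negbTE; lia.
have neq1' n : (n.+1 == n)%N = false by apply/negbTE; lia.
have neq2 n : (n == n.+2)%N = false by apply/negbTE; lia.
have neq2' n : (n.+2 == n)%N = false by apply/negbTE; lia.
have neq3 n : (n == n.+3)%N = false by apply/negbTE; lia.
have sub1 n : (n - n.+1 = 0)%N by lia.
have sub2 n : (n - n.+2 = 0)%N by lia.
have sub3 n : (n.+2 - n = 2)%N by lia.
have sub4 n : (n - n.+3 = 0)%N by lia.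
have sub5 n : (n.+3 - n = 3)%N by lia.
have sub6 n : (n.+4 - n = 4)%N by lia.
have neq3' n : (n.+3 == n)%N = false by apply/negbTE; lia.
pose nat_simp := (addn0, addn1, addn2, subn0, subSS, subnn, subSnn, sub1, sub2,
  sub3, sub4, sub5, sub6, eqSS, eqxx, neq1, neq1', neq2, neq2', neq3, neq3').
pose zero_simp := (mul0r, if_same, mulr0, addr0, add0r).
pose D := (1 - s * u)^-1 * (1 - s * v)^-1.
(* The difference of [k] and [i] fixes how many paths leave on the right for a given number
   entering. *)
have [e|[e|[e|[e|e]]]] :
    k = i.+2 \/ k = i.+1 \/ k = i \/ i = k.+1 \/ i = k.+2 by lia.
- rewrite {}e ?nat_simp /= ?nat_simp /= ?zero_simp H00.
  by split => //; ring.
- rewrite {}e ?nat_simp /= ?nat_simp /= ?zero_simp H00.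
  split; [by [] | | by rewrite !exprS; ring | by rewrite !exprS; ring].
  (* When one path leaves, the difference of the two sides is a combination of [H1] and [H2]; the
     coefficients solve this linear system, and [D] collects the normalisations. *)
  apply: (eq_comb2 (a := (1 - q ^+ i.+1) * D)
    (b := - (1 - q ^+ i.+1) * D * s * q ^+ i) H1 H2).
  by rewrite /D !exprS; ring.
(* For [i = 0] the intermediate occupation [i - 1] would be truncated. *)
- rewrite {}e {ik}; case: i => [|i].
    rewrite ?nat_simp /= ?nat_simp /= ?zero_simp H00 H11.
    split; [ring | ring | |].
      apply: (eq_comb2 (a := (u + v - s * (1 + u * v)) * D)
        (b := u * v * (s ^+ 2 - 1) * D) H1 H2).
      by rewrite /D; ring.
    apply: (eq_comb2 (a := (1 + q - s ^+ 2 - q) * D)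
        (b := (s ^+ 2 * (u + v) - s - s * u * v) * D) H1 H2).
    by rewrite /D; ring.
  rewrite ?nat_simp /= ?nat_simp /= ?zero_simp H00 H11.
  split; [ring | ring | |].
    apply: (eq_comb2 (a := (u + v - s * q ^+ i.+1 * (1 + u * v)) * D)
      (b := u * v * (q ^+ i.+1 * (s ^+ 2 * q ^+ i.+1 - 1) -
        s ^+ 2 * q ^+ i * (1 - q ^+ i.+1)) * D) H1 H2).
    by rewrite /D !exprS; ring.
  apply: (eq_comb2
    (a := (1 + q - s ^+ 2 * q ^+ i.+1 - q * q ^+ i.+1) * D)
    (b := (s ^+ 2 * q ^+ i.+1 ^+ 2 * (u + v) - s * q ^+ i.+1 -
      s * u * v * q ^+ i.+1) * D) H1 H2).
  by rewrite /D !exprS; ring.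
- rewrite {}e ?nat_simp /= ?nat_simp /= ?zero_simp H11.
  split; [ | by [] | by rewrite !exprS; ring | by rewrite !exprS; ring].
  apply: (eq_comb2 (a := (1 - s ^+ 2 * q ^+ k) * D)
    (b := - (1 - s ^+ 2 * q ^+ k) * D * s * u * v * q ^+ k) H1 H2).
  by rewrite /D !exprS; ring.
- rewrite {}e ?nat_simp /= ?nat_simp /= ?zero_simp H11.
  by split => //; ring.
Qed.

End SixVertex.

(** * Fusion *)

Section Fusion.

Variables (K : fieldType) (q s : K).
Hypotheses (hq : forall m, qpoch q q m != 0)
  (hs : forall m, qpoch q (s ^+ 2) m != 0).

Local Notation W := (vertex_weight q s).
Local Notation lw := (left_weight q s).

Lemma qpochS a m : qpoch q a m.+1 = qpoch q a m * (1 - a * q ^+ m).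
Proof. by rewrite /qpoch big_ord_recr. Qed.

Lemma qpoch_shift a m : (1 - a) * qpoch q (a * q) m = qpoch q a m.+1.
Proof.
rewrite /qpoch big_ord_recl expr0 mulr1; congr (_ * _).
by apply: eq_bigr => i _; rewrite exprS mulrA.
Qed.

Lemma left_weight0 x : lw x 0 = 1.
Proof. by rewrite /left_weight /xqpoch /qpoch !big_ord0 divr1. Qed.

Lemma left_weightS x n :
  lw x n.+1 = lw x n * ((x + s * q ^+ n) / (1 - q ^+ n.+1)).
Proof.
by rewrite /left_weight /xqpoch big_ord_recr qpochS exprS /= invfM; ring.
Qed.

(** For [r > 0] the factor [x * q + s * q ^+ r] is [q] times the factor of index [r - 1] at [x]. *)
Lemma left_weight_shift x n :
  lw (x * q) n.+1 = lw x n * (q ^+ n * (x * q + s) / (1 - q ^+ n.+1)).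
Proof.
rewrite /left_weight /xqpoch big_ord_recl qpochS expr0 mulr1.
rewrite (eq_bigr (fun i : 'I_n => x * q + s * q ^+ i.+1)) //.
have -> : \prod_(i < n) (x * q + s * q ^+ i.+1) =
    q ^+ n * \prod_(i < n) (x + s * q ^+ i).
  elim: n => [|n IH]; first by rewrite !big_ord0 mulr1.
  by rewrite !big_ord_recr /= IH !exprS; ring.
by rewrite invfM -exprS; ring.
Qed.

(* The part of the vertex weight that does not depend on the right edge [l];
   here [d = i - l]. *)
Definition vertex_core (x : K) (d k : nat) : K :=
  qpoch q (- (s * x)) d * qpoch q q k / (qpoch q q d * qpoch q (s ^+ 2) k).

(** The right edge contributes exactly a left boundary weight, so each column hands a boundary
    weight over to the next one. *)
Lemma vertex_weightE x l d j k : (l + d + j = k + l)%N ->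
  W x (l + d) j k l = lw x l * vertex_core x d k.
Proof.
move=> e; rewrite /vertex_weight e eqxx leq_addr /= addKn.
by rewrite /left_weight /vertex_core !invfM; ring.
Qed.

Lemma vertex_coreSk x d k :
  vertex_core x d k.+1 =
    vertex_core x d k * ((1 - q ^+ k.+1) / (1 - s ^+ 2 * q ^+ k)).
Proof. by rewrite /vertex_core !qpochS [q ^+ k.+1]exprS !invfM; ring. Qed.

Lemma vertex_core_shift x d k :
  (1 + s * x) * vertex_core (x * q) d k =
  vertex_core x d k * (1 + s * x * q ^+ d).
Proof.
have e : (1 + s * x) * qpoch q (- (s * (x * q))) d =
    qpoch q (- (s * x)) d * (1 + s * x * q ^+ d).
  have := qpoch_shift (- (s * x)) d; rewrite qpochS.
  by rewrite !mulNr !opprK -[s * x * q]mulrA.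
rewrite /vertex_core.
transitivity ((1 + s * x) * qpoch q (- (s * (x * q))) d * qpoch q q k /
  (qpoch q q d * qpoch q (s ^+ 2) k)); first by ring.
by rewrite e; ring.
Qed.

Lemma vertex_core_shiftS x d k :
  (1 + s * x) * vertex_core (x * q) d k =
  vertex_core x d.+1 k * (1 - q ^+ d.+1).
Proof.
rewrite vertex_core_shift /vertex_core !qpochS.
have := hq d.+1; rewrite qpochS mulf_eq0 => /norP[d0 d1].
have := hs k => k0.
by rewrite [q ^+ d.+1]exprS; field; rewrite k0 d0 d1.
Qed.

Lemma one_subqX_neq0 n : 1 - q ^+ n.+1 != 0.
Proof. by have := hq n.+1; rewrite qpochS mulf_eq0 exprS => /norP[]. Qed.

Lemma one_sub_s2qX_neq0 n : 1 - s ^+ 2 * q ^+ n != 0.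
Proof. by have := hs n.+1; rewrite qpochS mulf_eq0 => /norP[]. Qed.

(** The [n.+1] entering paths all take the lower row, or one of them takes the six-vertex row above;
    the upper row emits nothing to the right. Expanding the shifts leaves a rational identity in
    [q ^+ n] and [q ^+ d]. *)
Lemma fusion_local0 x n d :
  lw x n.+1 * vertex_core x d (n.+1 + d) * (1 + s * x * q ^+ (n.+1 + d)) +
  lw x n * (- x) * vertex_core x d (n + d) * (1 - q ^+ (n.+1 + d)) =
  (1 + s * x) * lw (x * q) n.+1 * vertex_core (x * q) d (n.+1 + d).
Proof.
rewrite [RHS]mulrAC vertex_core_shift addSn vertex_coreSk left_weightS.
rewrite left_weight_shift ![q ^+ _.+1]exprS !exprD.
have := one_subqX_neq0 n; rewrite exprS => n0.
have := one_sub_s2qX_neq0 (n + d); rewrite exprD => nd0.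
by field; rewrite n0 nd0.
Qed.

(** The same split when the upper row emits one path to the right, with a common factor [- x]
    removed. *)
Lemma fusion_local1 x n e :
  lw x n.+1 * vertex_core x e (n.+1 + e) * (1 - s ^+ 2 * q ^+ (n + e)) -
  lw x n * vertex_core x e (n + e) * (x + s * q ^+ (n + e)) =
  lw (x * q) n.+1 * vertex_core x e (n + e) * (1 - q ^+ e).
Proof.
rewrite addSn vertex_coreSk left_weightS.
rewrite left_weight_shift ![q ^+ _.+1]exprS !exprD.
have := one_subqX_neq0 n; rewrite exprS => n0.
have := one_sub_s2qX_neq0 (n + e); rewrite exprD => nd0.
by field; rewrite n0 nd0.
Qed.

Variable (x : K).
Hypothesis (sx : 1 + s * x != 0).

Local Notation L := (six_vertex q s (- x)).
Local Notation V i k l :=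
  (if (l <= i)%N then vertex_core (x * q) (i - l) k else 0).

Lemma vertex_weight_gt y i j k l : (i < l)%N -> W y i j k l = 0.
Proof. by rewrite /vertex_weight ltnNge => /negPf->; rewrite andbF. Qed.

(** The coefficient, after one column, of the two-row function with [l] paths leaving below and none
    above. The edge [k.-1] occurs when the upper row sends its path upwards. *)
Lemma fusion_coef0 i n k l : (i + n = k + l)%N ->
  lw x n * W x i n k l * L k 0 k 0 +
  (if n is m.+1 then lw x m * (- x) * W x i m k.-1 l * L k.-1 1 k 0 else 0) =
  lw (x * q) n * V i k l * lw x l.
Proof.
case: (leqP l i) => [/subnKC <-|li _]; last first.
  by case: n => [|m]; rewrite !vertex_weight_gt // !(mulr0, mul0r) addr0.
move: (i - l)%N => d e; have {e}-> : k = (n + d)%N by lia.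
rewrite addKn /six_vertex !addn0 eqxx.
rewrite vertex_weightE; last by lia.
case: n => [|m]; rewrite ?addSn /=.
  rewrite !left_weight0 !add0n addr0 mulrN opprK; apply: (mulfI sx).
  transitivity (lw x l * ((1 + s * x) * vertex_core (x * q) d d)); last by ring.
  by rewrite vertex_core_shift; field.
rewrite vertex_weightE; last by lia.
rewrite addn1 eqxx; apply: (mulfI sx).
transitivity (lw x l * ((1 + s * x) * lw (x * q) m.+1
    * vertex_core (x * q) d (m.+1 + d))); last by rewrite addSn; ring.
by rewrite -fusion_local0 mulrN opprK !addSn; field.
Qed.

(** The counterpart with one path leaving in the upper row, hence [l.+1] in all. *)
Lemma fusion_coef1 i n k l : (i + n = k + l.+1)%N ->
  lw x n * W x i n k.+1 l * L k.+1 0 k 1 +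
  (if n is m.+1 then lw x m * (- x) * W x i m k l * L k 1 k 1 else 0) =
  lw (x * q) n * V i k l.+1 * lw x l * (- x).
Proof.
case: (leqP l i) => [/subnKC <-|li _]; last first.
  rewrite (leqNgt l.+1) ltnS (ltnW li) /=.
  by case: n => [|m]; rewrite !vertex_weight_gt // !(mulr0, mul0r) addr0.
move: (i - l)%N => [|d] e; rewrite /six_vertex !addn0 addn1 !eqxx.
  (* For [i = l] the fused vertex cannot emit [l.+1] paths, and the two terms cancel because
     [1 - q ^+ e] is zero at [e = 0]. *)
  have {e}-> : n = k.+1 by lia.
  rewrite ltnn -[X in W x X](addn0 l) !vertex_weightE; try by lia.
  have := fusion_local1 x k 0; rewrite !addn0 expr0 subrr mulr0 => /eqP.
  rewrite subr_eq0 => /eqP h; rewrite mulr0 !mul0r mulrN opprK.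
  rewrite [_ * (lw x l * _)]mulrCA.
  transitivity (lw x l * (- x) / (1 + s * x) *
    (lw x k.+1 * vertex_core x 0 k.+1 * (1 - s ^+ 2 * q ^+ k) -
     lw x k * vertex_core x 0 k * (x + s * q ^+ k))); first by ring.
  by rewrite h; ring.
have {e}-> : k = (n + d)%N by lia.
have -> : V (l + d.+1)%N (n + d)%N l.+1 = vertex_core (x * q) d (n + d).
  by rewrite -addSnnS leq_addr addKn.
rewrite vertex_weightE; last by lia.
rewrite mulrN opprK; apply: (mulfI sx).
case: n => [|m].
  rewrite !left_weight0 !add0n addr0 vertex_coreSk.
  transitivity (lw x l * (- x) * ((1 + s * x) * vertex_core (x * q) d d));
    last by ring.
  rewrite vertex_core_shiftS; have := one_sub_s2qX_neq0 d => h.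
  by field; rewrite sx h.
rewrite vertex_weightE; last by lia.
transitivity (lw x l * (- x) * (lw (x * q) m.+1 * ((1 + s * x) *
  vertex_core (x * q) d (m.+1 + d)))); last by ring.
rewrite vertex_core_shiftS addSnnS [lw (x * q) _ * _]mulrA -fusion_local1.
rewrite !addSn !addnS.
by field.
Qed.

(** In all, [n] paths enter, at most one of them in the upper row. With the boundary weights kept in
    the statement, [vertex_weightE] reproduces the same combination for the next column. *)
Lemma fusion_pf N : (1 < N)%N -> forall n bs ts, (sumn ts < N)%N ->
  let Z := row2_pf N (W x) L in
  lw x n * Z n 0%N bs ts +
    (if n is m.+1 then lw x m * (- x) * Z m 1%N bs ts else 0) =
  lw (x * q) n * row_pf N (W (x * q)) n bs ts.
Proof.
move=> N2 n bs ts; elim: bs ts n => [|i bs IH] [|k ts] n ltN Z; rewrite /Z.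
- by case: n => [|m]; rewrite /= ?andbF ?mulr0 ?addr0 // !left_weight0.
- by case: n => [|m]; rewrite /= ?mulr0 ?addr0.
- by case: n => [|m]; rewrite /= ?mulr0 ?addr0.
have {}IH := IH ts _ (leq_ltn_trans (leq_addl k _) ltN).
rewrite [sumn _]/= in ltN.
have cW y : conserving (W y) by apply: vertex_weight_conserving.
have cL : conserving L by apply: six_vertex_conserving.
have rL := @six_vertex_right _ q s (- x).
rewrite row_pf_cons // !(@row2_pf_cons01 _ N (W x) L) //.
rewrite !addn0 !subn0.
have -> : match n with 0%N => 0 | m.+1 => lw x m * - x *
    row2_pf N (W x) L m 1 (i :: bs) (k :: ts) end =
  (if n is m.+1 then lw x m * - x * W x i m k.-1 (i + n - k) *
     L k.-1 1 k 0 else 0) * row2_pf N (W x) L (i + n - k) 0 bs ts +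
  (if n is m.+1 then lw x m * - x * W x i m k (i + n - k.+1) *
     L k 1 k 1 else 0) * row2_pf N (W x) L (i + n - k.+1) 1 bs ts.
  case: n => [|m]; first by rewrite !mul0r addr0.
  rewrite (@row2_pf_cons01 _ N (W x) L) // !subn1 /= addn1 -addnS.
  by ring.
move: (row2_pf N (W x) L) (row_pf N (W (x * q))) IH => {Z} Z R IH.
(* If [i + n < k] every term vanishes by conservation; otherwise [i + n - k] is an exact
   subtraction. *)
have [lt|le] := ltnP (i + n) k.
  have h y m k' l : (k <= k' + (n - m))%N -> (m <= n)%N -> W y i m k' l = 0.
    by move=> k'k mn; apply: cW; lia.
  rewrite !(h _ n); try by lia.
  case: n {IH h} lt => [|m] lt; rewrite ?cW; try by lia.
    by rewrite !(mul0r, mulr0, addr0).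
  by rewrite !(mul0r, mulr0, addr0).
have E : (i + n = k + (i + n - k))%N by lia.
move: (i + n - k)%N E (IH (i + n - k)%N) => l E {}IH.
have -> : W (x * q) i n k l = lw (x * q) l * V i k l.
  case: leqP => li; last by rewrite vertex_weight_gt // mulr0.
  by rewrite -{1}(subnKC li) vertex_weightE //; lia.
transitivity (lw (x * q) n * V i k l * (lw (x * q) l * R l bs ts));
  last by ring.
rewrite -{}IH; have C0 := fusion_coef0 E.
case: l E C0 => [|l] E C0.
  rewrite [W x i n k.+1 _]cW; last by lia.
  have -> : (if n is m.+1 then lw x m * - x * W x i m k (i + n - k.+1) *
     L k 1 k 1 else 0) = 0.
    by case: n E {C0 le} => [|m] E //; rewrite cW ?(mulr0, mul0r) //; lia.
  transitivity (lw (x * q) n * V i k 0%N * lw x 0 * Z 0%N 0%N bs ts);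
    last by ring.
  by rewrite -C0; clear; case: n => [|m]; ring.
have C1 := fusion_coef1 E.
have -> : (i + n - k.+1 = l)%N by lia.
transitivity (lw (x * q) n * V i k l.+1 * lw x l.+1 * Z l.+1 0%N bs ts +
  lw (x * q) n * V i k l.+1 * lw x l * - x * Z l 1%N bs ts); last by ring.
by rewrite -C0 -C1; clear; case: n => [|m]; ring.
Qed.

End Fusion.

(** * Transfer operators *)

Lemma big_tuple_cons (V : nmodType) (A : finType) (M : nat)
    (F : M.+1.-tuple A -> V) :
  \sum_t F t = \sum_a \sum_(t : M.-tuple A) F [tuple of a :: t].
Proof.
rewrite pair_bigA /=.
rewrite (reindex (fun p : A * M.-tuple A => [tuple of p.1 :: p.2])) //=.
exists (fun t => (thead t, [tuple of behead t])) => [[a t] _|t _] /=.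
  by congr (_, _); apply: val_inj.
by rewrite -tuple_eta.
Qed.

Section Operators.

Variables (K : fieldType) (M N : nat).
Implicit Types (w : nat -> nat -> nat -> nat -> K) (g : nat -> K).

(** A finite type, so that transfer operators are finite matrices. *)
Definition state : finType := M.-tuple 'I_N.
Definition occ (t : state) : seq nat := map val t.

Lemma size_occ (t : state) : size (occ t) = M.
Proof. by rewrite size_map size_tuple. Qed.

(** [g] weighs the paths emitted by column 0, an infinite reservoir. *)
Definition row_kernel g w bs ts : K := \sum_(j < N) g j * row_pf N w j bs ts.

(* Only states with fewer than [N] paths are kept: every state reachable
   downwards from such a state fits into [state]. *)
Definition row_op g w (phi : {ffun state -> K}) : {ffun state -> K} :=
  [ffun nu => if (sumn (occ nu) < N)%N
    then \sum_mu row_kernel g w (occ mu) (occ nu) * phi mu else 0].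

Definition row2_kernel g1 w1 g2 w2 bs ts : K :=
  \sum_(j1 < N) \sum_(j2 < N) g1 j1 * g2 j2 * row2_pf N w1 w2 j1 j2 bs ts.

Lemma row_kernel_eq0 g w bs ts : conserving w ->
  (sumn ts < sumn bs)%N -> row_kernel g w bs ts = 0.
Proof.
move=> cw lt; rewrite /row_kernel big1 // => j _.
by rewrite row_pf_eq0 ?mulr0 //; lia.
Qed.

End Operators.

(** Passes from the joint recursion to separate rows by naming the state between them. *)
Lemma row2_pf_sum (K : fieldType) N (w1 w2 : nat -> nat -> nat -> nat -> K)
    M j1 j2 bs ts : size bs = M -> size ts = M ->
  row2_pf N w1 w2 j1 j2 bs ts =
    \sum_(t : state M N) row_pf N w1 j1 bs (occ t) * row_pf N w2 j2 (occ t) ts.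
Proof.
elim: M bs ts j1 j2 => [|M IH] [|i bs] [|k ts] j1 j2 //= => [_ _|[sb] [st]].
  rewrite (big_pred1 [tuple]) /= => [|t]; last by apply/esym/eqP/tuple0.
  by rewrite -natrM mulnb.
rewrite big_tuple_cons /=.
transitivity (\sum_(l1 < N) \sum_(l2 < N) \sum_(m < N) \sum_(t : state M N)
  (w1 i j1 m l1 * row_pf N w1 l1 bs (occ t)) *
  (w2 m j2 k l2 * row_pf N w2 l2 (occ t) ts)).
  apply: eq_bigr => l1 _; apply: eq_bigr => l2 _; apply: eq_bigr => m _.
  by rewrite IH // mulr_sumr; apply: eq_bigr => t _; rewrite mulrACA.
have ex3 (F : 'I_N -> 'I_N -> 'I_N -> K) :
    \sum_a \sum_b \sum_c F a b c = \sum_c \sum_a \sum_b F a b c.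
  by rewrite [RHS]exchange_big; apply: eq_bigr => a _; rewrite exchange_big.
rewrite ex3; apply: eq_bigr => m _.
rewrite pair_bigA exchange_big /=; apply: eq_bigr => t _.
by rewrite big_distrlr pair_bigA.
Qed.

Section Composition.

Variables (K : fieldType) (M N : nat).
Implicit Types (w : nat -> nat -> nat -> nat -> K) (g : nat -> K).
Implicit Type phi : {ffun state M N -> K}.

Lemma row_op_comp g1 w1 g2 w2 phi nu : conserving w2 ->
  row_op g2 w2 (row_op g1 w1 phi) nu =
  if (sumn (occ nu) < N)%N
    then \sum_mu row2_kernel N g1 w1 g2 w2 (occ mu) (occ nu) * phi mu else 0.
Proof.
move=> c2; rewrite ffunE; case: ifP => // ltN.
transitivity (\sum_(kappa : state M N) \sum_(mu : state M N)
  row_kernel N g1 w1 (occ mu) (occ kappa) *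
  row_kernel N g2 w2 (occ kappa) (occ nu) * phi mu).
  apply: eq_bigr => t _; rewrite ffunE; case: ltnP => [lt|le].
    by rewrite mulr_sumr; apply: eq_bigr => mu _; ring.
  (* An intermediate state that was cut off cannot contribute, since the upper row removes no
     paths. *)
  rewrite mulr0 big1 // => mu _.
  by rewrite [row_kernel _ g2 _ _ _]row_kernel_eq0 ?mulr0 ?mul0r //; lia.
rewrite exchange_big; apply: eq_bigr => mu _.
rewrite -mulr_suml; congr (_ * _).
transitivity (\sum_(t : state M N) \sum_(j1 < N) \sum_(j2 < N)
  g1 j1 * g2 j2 *
  (row_pf N w1 j1 (occ mu) (occ t) * row_pf N w2 j2 (occ t) (occ nu))).
  apply: eq_bigr => t _; rewrite mulr_suml; apply: eq_bigr => j1 _.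
  by rewrite mulr_sumr; apply: eq_bigr => j2 _; rewrite mulrACA.
rewrite exchange_big; apply: eq_bigr => j1 _.
rewrite exchange_big; apply: eq_bigr => j2 _.
by rewrite -mulr_sumr -row2_pf_sum // size_occ.
Qed.

Definition trunc phi : {ffun state M N -> K} :=
  [ffun nu => if (sumn (occ nu) < N)%N then phi nu else 0].

Lemma row_op_trunc g w phi : conserving w ->
  row_op g w (trunc phi) = row_op g w phi.
Proof.
move=> cw; apply/ffunP => nu; rewrite !ffunE; case: ifP => // lt.
apply: eq_bigr => mu _; rewrite ffunE; case: ltnP => // le.
by rewrite row_kernel_eq0 ?mul0r //; lia.
Qed.

Lemma trunc_row_op g w phi : trunc (row_op g w phi) = row_op g w phi.
Proof. by apply/ffunP => nu; rewrite !ffunE; case: (_ < N)%N. Qed.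

End Composition.

(** * Commutation at the points [- s * q ^+ J] *)

Section Commutation.

Variables (K : fieldType) (q s : K) (M N : nat).
Hypotheses (hq : forall m, qpoch q q m != 0)
  (hs : forall m, qpoch q (s ^+ 2) m != 0) (N2 : (1 < N)%N).
Implicit Type phi : {ffun state M N -> K}.

Local Notation W := (vertex_weight q s).
Local Notation lw := (left_weight q s).

Definition six_left (u : K) (l : nat) : K :=
  match l with 0 => 1 | 1 => u | _ => 0 end.

Definition six_op u phi := row_op (six_left u) (six_vertex q s u) phi.
Definition spin_op x phi := row_op (lw x) (W x) phi.

(** Expanding the left boundaries by the number of entering paths leaves three parts, each invariant
    by one exchange relation. *)
Lemma six_op_comm u v phi : s * u != 1 -> s * v != 1 ->
  six_op v (six_op u phi) = six_op u (six_op v phi).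
Proof.
move=> su sv; apply/ffunP => nu.
rewrite !row_op_comp; try exact: six_vertex_conserving.
case: ifP => // lt; apply: eq_bigr => mu _; congr (_ * _).
have E a b : row2_kernel N (six_left a) (six_vertex q s a) (six_left b)
    (six_vertex q s b) (occ mu) (occ nu) =
  let Z j1 j2 := row2_pf N (six_vertex q s a) (six_vertex q s b) j1 j2
    (occ mu) (occ nu) in
  Z 0%N 0%N + (a * Z 1%N 0%N + b * Z 0%N 1%N) + a * b * Z 1%N 1%N.
  rewrite /row2_kernel (big_ord01 (f := fun j1 => \sum_(j2 < N) six_left a j1 *
    six_left b j2 * row2_pf _ _ _ j1 j2 _ _)) //; last first.
    by case=> [|[|l]] // _; rewrite big1 // => j2 _; rewrite !mul0r.
  rewrite !(big_ord01 (f := fun j2 => six_left a _ *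
    six_left b j2 * row2_pf _ _ _ _ j2 _ _)) //=; first by ring.
    by case=> [|[|l]] // _; rewrite mulr0 mul0r.
  by case=> [|[|l]] // _; rewrite mulr0 mul0r.
rewrite !E /=; have [-> -> -> _] := six_vertex_exchange q N2 su sv (occ mu) lt.
by rewrite [u * v]mulrC.
Qed.

(** Grouping the boundary sum by the total number of entering paths gives the combination in
    [fusion_pf]. *)
Lemma spin_op_fusion x phi : 1 + s * x != 0 ->
  six_op (- x) (spin_op x phi) = spin_op (x * q) phi.
Proof.
move=> sx; apply/ffunP => nu.
rewrite row_op_comp; last exact: six_vertex_conserving.
rewrite ffunE; case: ifP => // lt; apply: eq_bigr => mu _; congr (_ * _).
pose Z j1 j2 := row2_pf N (W x) (six_vertex q s (- x)) j1 j2 (occ mu) (occ nu).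
transitivity (\sum_(n < N) (lw x n * Z n 0%N + lw x n * (- x) * Z n 1%N)).
  apply: eq_bigr => n _.
  rewrite (big_ord01 (f := fun j2 => lw x n * six_left (- x) j2 * Z n j2)) //=.
    by rewrite mulr1.
  by case=> [|[|l]] // _; rewrite mulr0 mul0r.
(* Terms with a path in the upper row move from [m] to their total [m.+1]. The last one is zero: it
   has [N] entering paths, more than the top carries. *)
have shift (f : nat -> K) : f N.-1 = 0 ->
    \sum_(n < N) f n = \sum_(n < N) (if n : nat is m.+1 then f m else 0).
  case: N N2 => // N' _ f0; rewrite big_ord_recr /= f0 addr0.
  by rewrite big_ord_recl add0r.
rewrite big_split /= (shift (fun n => lw x n * (- x) * Z n 1%N)); last first.
  rewrite [Z _ _]row2_pf_eq0 ?mulr0 //; first exact: vertex_weight_conserving.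
    exact: six_vertex_conserving.
  by lia.
by rewrite -big_split; apply: eq_bigr => n _; rewrite -fusion_pf.
Qed.

(** At [x = - s] the first factor of [xqpoch] vanishes, so horizontal edges are empty, and vertices
    with only vertical paths have weight 1. Large states are discarded by [row_op], whence
    [trunc]. *)
Lemma spin_op_trivial phi : spin_op (- s) phi = trunc phi.
Proof.
have x0 l : (0 < l)%N -> xqpoch q s (- s) l = 0.
  by case: l => // l _; rewrite /xqpoch big_ord_recl expr0 mulr1 addNr mul0r.
have Wkk k : W (- s) k 0 k 0 = 1.
  rewrite /vertex_weight eqxx subn0 /= mulrN opprK -expr2.
  rewrite /xqpoch /qpoch !big_ord0 !mul1r -/(qpoch q q k).
  rewrite -/(qpoch q (s ^+ 2) k) [qpoch q (s ^+ 2) k * _]mulrC divff //.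
  by rewrite mulf_neq0 ?hq ?hs.
have row0 bs ts : (sumn ts < N)%N ->
    row_pf N (W (- s)) 0 bs ts = (bs == ts)%:R.
  elim: bs ts => [|i bs IH] [|k ts] //= lt.
  have := @row_pf_cons _ N (W (- s)) 0 i bs k ts.
  rewrite /= => -> //; last exact: vertex_weight_conserving.
  have [ltik|ltki|<-] := ltngtP i k.
  - rewrite vertex_weight_conserving ?mul0r; last by lia.
    by rewrite eqseq_cons (ltn_eqF ltik).
  - rewrite /vertex_weight x0; last by lia.
    by rewrite !mul0r if_same mul0r eqseq_cons (gtn_eqF ltki).
  - rewrite addn0 subnn Wkk mul1r eqseq_cons eqxx; apply: IH; lia.
have kern bs ts : (sumn ts < N)%N ->
    row_kernel N (lw (- s)) (W (- s)) bs ts = (bs == ts)%:R.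
  move=> lt; rewrite /row_kernel.
  rewrite (big_ord01 (f := fun j => lw (- s) j * row_pf _ _ j _ _)) //.
    by rewrite left_weight0 mul1r row0 // /left_weight x0 // !mul0r addr0.
  by move=> l l1; rewrite /left_weight x0 ?mul0r //; lia.
apply/ffunP => nu; rewrite !ffunE; case: ifP => // lt.
rewrite (bigD1 nu) //= kern // eqxx mul1r big1 ?addr0 // => mu ne.
rewrite kern // (inj_eq (inj_map val_inj)) -(inj_eq val_inj) in ne *.
by rewrite (negPf ne) mul0r.
Qed.

(** By fusion the operator at [J.+1] is a six-vertex operator after the one at [J]. The
    normalisation [1 + s * x] is [1 - s ^+ 2 * q ^+ J], nonzero by [hs]. *)
Lemma six_spin_op_comm u J phi : s * u != 1 ->
  six_op u (spin_op (- s * q ^+ J) phi) = spin_op (- s * q ^+ J) (six_op u phi).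
Proof.
move=> su; elim: J => [|J IH].
  rewrite expr0 mulr1 !spin_op_trivial /six_op /spin_op.
  rewrite trunc_row_op row_op_trunc //.
  exact: six_vertex_conserving.
have sJ : 1 + s * (- s * q ^+ J) != 0.
  by rewrite mulrA mulrN mulNr -expr2; apply: one_sub_s2qX_neq0.
rewrite exprSr mulrA -!spin_op_fusion // six_op_comm ?IH //.
by rewrite -subr_eq0 -opprB oppr_eq0 mulrN opprK.
Qed.

(** The same induction, the six-vertex factor now moving past the whole second operator. *)
Lemma spin_op_comm_qX J J' phi :
  spin_op (- s * q ^+ J) (spin_op (- s * q ^+ J') phi) =
  spin_op (- s * q ^+ J') (spin_op (- s * q ^+ J) phi).
Proof.
elim: J => [|J IH].
  rewrite expr0 mulr1 !spin_op_trivial /six_op /spin_op.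
  rewrite trunc_row_op row_op_trunc //.
  exact: vertex_weight_conserving.
have sJ : 1 + s * (- s * q ^+ J) != 0.
  by rewrite mulrA mulrN mulNr -expr2; apply: one_sub_s2qX_neq0.
rewrite exprSr mulrA -!spin_op_fusion // IH six_spin_op_comm //.
by rewrite -subr_eq0 -opprB oppr_eq0 mulrN opprK.
Qed.

End Commutation.

(** * Interpolation *)

Section RationalOn.

Variables (K : fieldType) (A : K -> Prop).
Implicit Types (f g : K -> K).

(** The fraction has no pole on [A]; outside [A] nothing is asked of [f]. *)
Definition rational_on f := exists P D : {poly K},
  forall t, A t -> D.[t] != 0 /\ f t = P.[t] / D.[t].

Lemma rational_on_cst c : rational_on (fun=> c).
Proof. by exists c%:P, 1 => t _; rewrite !hornerE oner_neq0 divr1. Qed.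

Lemma rational_on_id : rational_on id.
Proof. by exists 'X, 1 => t _; rewrite !hornerE oner_neq0 divr1. Qed.

Lemma rational_onD f g :
  rational_on f -> rational_on g -> rational_on (fun t => f t + g t).
Proof.
move=> [P [D h]] [P' [D' h']]; exists (P * D' + P' * D), (D * D') => t At.
have [D0 ->] := h t At; have [D'0 ->] := h' t At.
by rewrite !hornerE mulf_neq0 //; split=> //; field; rewrite D0 D'0.
Qed.

Lemma rational_onM f g :
  rational_on f -> rational_on g -> rational_on (fun t => f t * g t).
Proof.
move=> [P [D h]] [P' [D' h']]; exists (P * P'), (D * D') => t At.
have [D0 ->] := h t At; have [D'0 ->] := h' t At.
by rewrite !hornerM mulf_neq0 //; split=> //; field; rewrite D0 D'0.
Qed.

Lemma rational_onN f : rational_on f -> rational_on (fun t => - f t).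
Proof.
move=> [P [D h]]; exists (- P), D => t At; have [D0 ->] := h t At.
by rewrite hornerN mulNr.
Qed.

Lemma rational_onX f n : rational_on f -> rational_on (fun t => f t ^+ n).
Proof.
move=> rf; elim: n => [|n IH]; first exact: rational_on_cst.
have [P [D h]] := rational_onM rf IH; exists P, D => t At.
by rewrite exprS; apply: h.
Qed.

Lemma rational_onV f : rational_on f -> (forall t, A t -> f t != 0) ->
  rational_on (fun t => (f t)^-1).
Proof.
move=> [P [D h]] f0; exists D, P => t At; have [D0 e] := h t At.
rewrite e invfM invrK mulrC; split=> //.
by have := f0 t At; rewrite e mulf_eq0 => /norP[].
Qed.

Lemma rational_on_sum (I : Type) (r : seq I) (P : pred I) (F : I -> K -> K) :
  (forall i, rational_on (F i)) ->
  rational_on (fun t => \sum_(i <- r | P i) F i t).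
Proof.
move=> rF; elim: r => [|i r [Q [D h]]].
  have [Q [D h]] := rational_on_cst 0.
  by exists Q, D => t At; rewrite big_nil; apply: h.
case Pi: (P i); last by exists Q, D => t At; rewrite big_cons Pi; apply: h.
have [|Q' [D' h']] :=
  rational_onD (rF i) (g := fun t => \sum_(i <- r | P i) F i t).
  by exists Q, D.
by exists Q', D' => t At; rewrite big_cons Pi; apply: h'.
Qed.

Lemma rational_on_prod (I : Type) (r : seq I) (P : pred I) (F : I -> K -> K) :
  (forall i, rational_on (F i)) ->
  rational_on (fun t => \prod_(i <- r | P i) F i t).
Proof.
move=> rF; elim: r => [|i r [Q [D h]]].
  have [Q [D h]] := rational_on_cst 1.
  by exists Q, D => t At; rewrite big_nil; apply: h.
case Pi: (P i); last by exists Q, D => t At; rewrite big_cons Pi; apply: h.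
have [|Q' [D' h']] :=
  rational_onM (rF i) (g := fun t => \prod_(i <- r | P i) F i t).
  by exists Q, D.
by exists Q', D' => t At; rewrite big_cons Pi; apply: h'.
Qed.

(** As the denominator does not vanish on [A], the points [a n] are infinitely many roots of the
    numerator. *)
Lemma rational_on_eq0 f (a : nat -> K) : rational_on f -> injective a ->
  (forall n, A (a n)) -> (forall n, f (a n) = 0) ->
  forall t, A t -> f t = 0.
Proof.
move=> [P [D h]] ia Aa fa t At; have [_ ->] := h t At.
suff -> : P = 0 by rewrite horner0 mul0r.
apply: (@roots_geq_poly_eq0 _ P (map a (iota 0 (size P)))).
- apply/allP => _ /mapP[n _ ->]; have [Dn e] := h _ (Aa n).
  by move: (fa n); rewrite e => /eqP; rewrite mulf_eq0 invr_eq0 (negPf Dn) orbF.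
- by rewrite map_inj_uniq ?iota_uniq.
- by rewrite size_map size_iota.
Qed.

End RationalOn.

(** * Rational dependence of transfer operators on their parameters *)

Section SpinOpRational.

Variables (K : fieldType) (A : K -> Prop) (q s x : K -> K).
Hypotheses (rq : rational_on A q) (rs : rational_on A s) (rx : rational_on A x).
Hypotheses (hq : forall t, A t -> forall m, qpoch (q t) (q t) m != 0)
  (hs : forall t, A t -> forall m, qpoch (q t) (s t ^+ 2) m != 0).

Lemma rational_on_qpoch a m : rational_on A a ->
  rational_on A (fun t => qpoch (q t) (a t) m).
Proof.
move=> ra; apply: rational_on_prod => i.
apply: rational_onD; first exact: rational_on_cst.
by apply: rational_onN; apply: rational_onM => //; apply: rational_onX.
Qed.

Lemma rational_on_xqpoch l :
  rational_on A (fun t => xqpoch (q t) (s t) (x t) l).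
Proof.
apply: rational_on_prod => i; apply: rational_onD => //.
by apply: rational_onM => //; apply: rational_onX.
Qed.

Lemma rational_on_left_weight l :
  rational_on A (fun t => left_weight (q t) (s t) (x t) l).
Proof.
apply: rational_onM; first exact: rational_on_xqpoch.
by apply: rational_onV => [|t At]; [apply: rational_on_qpoch | apply: hq].
Qed.

Lemma rational_on_vertex_weight i j k l :
  rational_on A (fun t => vertex_weight (q t) (s t) (x t) i j k l).
Proof.
rewrite /vertex_weight; case: ((i + j == k + l)%N && (l <= i)%N);
  last exact: rational_on_cst.
apply: rational_onM.
  apply: rational_onM; last exact: rational_on_qpoch.
  apply: rational_onM; first exact: rational_on_xqpoch.
  by apply: rational_on_qpoch; apply: rational_onN; apply: rational_onM.
apply: rational_onV => [|t At]; last by rewrite !mulf_neq0 ?hq ?hs.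
apply: rational_onM; last first.
  exact: (rational_on_qpoch _ (rational_onX 2 rs)).
by apply: rational_onM; apply: rational_on_qpoch.
Qed.

Lemma rational_on_row_pf N j bs ts :
  rational_on A (fun t => row_pf N (vertex_weight (q t) (s t) (x t)) j bs ts).
Proof.
elim: bs j ts => [|i bs IH] j [|k ts] /=; try exact: rational_on_cst.
apply: rational_on_sum => l; apply: rational_onM => //.
exact: rational_on_vertex_weight.
Qed.

(** All parameters are functions of [t], so that any of them can vary; [phi] depends on [t] too, so
    that operators can be composed. *)
Lemma rational_on_spin_op M N (phi : K -> {ffun state M N -> K}) :
  (forall mu, rational_on A (fun t => phi t mu)) ->
  forall nu, rational_on A (fun t => spin_op (q t) (s t) (x t) (phi t) nu).
Proof.
move=> rphi nu.
have [P [D h]] : rational_on A (fun t => if (sumn (occ nu) < N)%N then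
    \sum_(mu : state M N) row_kernel N (left_weight (q t) (s t) (x t))
      (vertex_weight (q t) (s t) (x t)) (occ mu) (occ nu) * phi t mu else 0).
  case: (_ < N)%N; last exact: rational_on_cst.
  apply: rational_on_sum => mu; apply: rational_onM => //.
  apply: rational_on_sum => j; apply: rational_onM.
    exact: rational_on_left_weight.
  exact: rational_on_row_pf.
by exists P, D => t At; rewrite ffunE; apply: h.
Qed.

End SpinOpRational.

(** * Commutation for all [q] and [s] in the unit disc *)

Section SpinOpComm.

Variables (K : numFieldType) (M N : nat).
Hypothesis N2 : (1 < N)%N.
Implicit Types (q s x y : K) (phi : {ffun state M N -> K}).

Lemma qpoch_neq0 q a m : `|q| < 1 -> `|a| < 1 -> qpoch q a m != 0.
Proof.
move=> q1 a1; apply/prodf_neq0 => i _; rewrite subr_eq0; apply/eqP => e.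
have : `|a * q ^+ i| < 1.
  rewrite normrM normrX; apply: le_lt_trans a1.
  by rewrite ler_piMr // exprn_ile1 // ltW.
by rewrite -e normr1 ltxx.
Qed.

Lemma norm_sqr_lt1 s : `|s| < 1 -> `|s ^+ 2| < 1.
Proof. by move=> s1; rewrite normrX exprn_ilt1. Qed.

Definition spin_op_commutator q s x y phi nu : K :=
  spin_op q s x (spin_op q s y phi) nu - spin_op q s y (spin_op q s x phi) nu.

Lemma rational_on_commutator (A : K -> Prop) (q s x y : K -> K) phi nu :
  rational_on A q -> rational_on A s -> rational_on A x -> rational_on A y ->
  (forall t, A t -> `|q t| < 1) -> (forall t, A t -> `|s t| < 1) ->
  rational_on A (fun t => spin_op_commutator (q t) (s t) (x t) (y t) phi nu).
Proof.
move=> rq rs rx ry q1 s1.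
have hq t : A t -> forall m, qpoch (q t) (q t) m != 0.
  by move=> At m; rewrite qpoch_neq0 ?q1.
have hs t : A t -> forall m, qpoch (q t) (s t ^+ 2) m != 0.
  by move=> At m; rewrite qpoch_neq0 ?q1 ?norm_sqr_lt1 ?s1.
apply: rational_onD; last apply: rational_onN.
all: do 2 apply: rational_on_spin_op => //; move=> ?; exact: rational_on_cst.
Qed.

(** Interpolation nodes for both [q] and [s]; the shift by 2 keeps them nonzero and inside the unit
    disc. *)
Let recip n : K := n.+2%:R^-1.

Let recip_inj : injective recip.
Proof. by move=> m n /invr_inj/eqP; rewrite eqr_nat !eqSS => /eqP. Qed.

Let recip_neq0 n : recip n != 0.
Proof. by rewrite invr_eq0 pnatr_eq0. Qed.

Let recip_lt1 n : `|recip n| < 1.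
Proof. by rewrite normfV normr_nat invf_lt1 ?ltr0n // ltr1n. Qed.

Lemma spin_op_comm q s x y phi : `|q| < 1 -> `|s| < 1 ->
  spin_op q s x (spin_op q s y phi) = spin_op q s y (spin_op q s x phi).
Proof.
move=> q1 s1; apply/ffunP => nu; apply/subr0_eq.
rewrite -/(spin_op_commutator q s x y phi nu).
(* First the case of nonzero parameters, where the points [- s' * q' ^+ J] are pairwise distinct. *)
have qs0 q' s' x' y' : `|q'| < 1 -> `|s'| < 1 -> q' != 0 -> s' != 0 ->
    spin_op_commutator q' s' x' y' phi nu = 0.
  move=> {q1 s1}q1 s1 q0 s0.
  have hq m : qpoch q' q' m != 0 by rewrite qpoch_neq0.
  have hs m : qpoch q' (s' ^+ 2) m != 0 by rewrite qpoch_neq0 ?norm_sqr_lt1.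
  have inj : injective (fun J => - s' * q' ^+ J).
    move=> m n /mulfI-/(_ _)/[!oppr_eq0] /(_ s0) e.
    wlog lt : m n e / (m < n)%N => [th|].
      by case: (ltngtP m n) => // lt; [apply: th | symmetry; apply: th].
    (* A coincidence would make [q'] a root of unity. *)
    have := one_subqX_neq0 hq (n - m).-1; rewrite prednK ?subn_gt0 //.
    rewrite -(inj_eq (mulfI (expf_neq0 m q0))) mulr0 mulrBr mulr1 -exprD.
    by rewrite subnKC ?(ltnW lt) // e subrr eqxx.
  have rcst c : rational_on (fun=> True) (fun=> c : K).
    exact: rational_on_cst.
  have rid : rational_on (fun=> True) (@id K) by apply: rational_on_id.
  (* Interpolation in [x'], then in [y'], over the whole field. *)
  apply: (rational_on_eq0 (A := fun=> True)
      (f := fun t => spin_op_commutator q' s' t y' phi nu) _ inj) => //.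
    exact: rational_on_commutator.
  move=> J; apply: (rational_on_eq0 (A := fun=> True)
      (f := fun t => spin_op_commutator q' s' _ t phi nu) _ inj) => //.
    exact: rational_on_commutator.
  by move=> J'; rewrite /spin_op_commutator spin_op_comm_qX ?subrr.
have rcst c : rational_on (fun t => `|t| < 1) (fun=> c : K).
  exact: rational_on_cst.
have rid : rational_on (fun t => `|t| < 1) (@id K) by apply: rational_on_id.
(* Interpolation in [q], then in [s], inside the disc only; this includes the value zero. *)
apply: (rational_on_eq0 (A := fun t => `|t| < 1)
  (f := fun t => spin_op_commutator t s x y phi nu) _ recip_inj) => //.
  exact: rational_on_commutator.
move=> n; apply: (rational_on_eq0 (A := fun t => `|t| < 1)
  (f := fun t => spin_op_commutator _ t x y phi nu) _ recip_inj) => //.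
  exact: rational_on_commutator.
by move=> n'; apply: qs0.
Qed.

End SpinOpComm.

(** * Expansion over finitely many configurations *)

(** Commuting single steps gives commuting blocks, and block exchanges generate all permutations. *)
Lemma foldl_perm (T : eqType) (R : Type) (f : R -> T -> R) (z : R) s1 s2 :
  (forall r x y, f (f r x) y = f (f r y) x) ->
  perm_eq s1 s2 -> foldl f z s1 = foldl f z s2.
Proof.
move=> fC p.
have swap r s t : foldl f (foldl f r s) t = foldl f (foldl f r t) s.
  have swap1 r' x : foldl f (f r' x) t = f (foldl f r' t) x.
    by elim: t r' => //= y t IH r'; rewrite fC IH.
  by elim: s r => //= x s IH r; rewrite IH swap1.
apply: (@catCA_perm_ind _ (fun s => foldl f z s1 = foldl f z s) _ s1) => //.
move=> t1 t2 t3.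
by rewrite !foldl_cat (swap z t1).
Qed.

(** Replaces the sum over infinitely many configurations by one over a finite type covering the
    support. *)
Lemma fsbig_fin_inj (V : nmodType) (E : finType) (T : choiceType) (h : E -> T)
    (D : set T) (F : T -> V) : injective h ->
  (forall t, D t -> F t != 0 -> exists e, t = h e) ->
  \sum_(t \in D) F t = \sum_(e | `[< D (h e) >]) F (h e).
Proof.
move=> ih supp; rewrite -(fsbig_widen (h @` [set e | D (h e)])%classic).
- rewrite fsbig_image; last by move=> x y _ _; apply: ih.
  transitivity (\sum_(e <- [seq e <- enum E | `[< D (h e) >]]) F (h e));
    last by rewrite big_filter big_enum_cond.
  rewrite [RHS]fsbig_seq; last first.
    by rewrite filter_uniq ?index_enum_uniq ?enum_uniq.
  by apply: eq_fsbigl; apply/seteqP; split=> e /=;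
    rewrite mem_filter mem_enum andbT => ?; apply/asboolP.
- by move=> _ [e De <-].
- move=> t [Dt nt] /=; apply/eqP; apply: contra_notT nt => Ft.
  by have [e te] := supp t Dt Ft; exists e; rewrite -?te //= -te.
Qed.

Lemma fsprod_nat_ord (K : fieldType) (n : nat) (F : nat -> K) :
  (forall c, (n <= c)%N -> F c = 1) ->
  \big[*%R/1]_(c \in [set: nat]) F c = \prod_(c < n) F c.
Proof.
move=> F1; rewrite fsbig_ord; apply/esym/fsbig_widen => // c [_ /negP].
by rewrite -leqNgt => /F1.
Qed.

Lemma ord_chain_leq n (f : 'I_n.+1 -> nat) :
  (forall r : 'I_n, (f (widen_ord (leqnSn n) r) <= f (lift ord0 r))%N) ->
  forall r, (f r <= f ord_max)%N.
Proof.
move=> mono r; move: {2}(n - r)%N (erefl (n - r)%N) => k.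
elim: k r => [|k IH] r e.
  by rewrite (_ : r = ord_max) //; apply: val_inj => /=; have := ltn_ord r; lia.
have lt : (r < n)%N by lia.
have := mono (Ordinal lt).
rewrite (_ : widen_ord _ _ = r); last exact: val_inj.
by move=> /leq_trans; apply; apply: IH; rewrite lift0 /=; lia.
Qed.

Lemma big_ffun_ordS (V : nmodType) (S : finType) n
    (F : {ffun 'I_n.+1 -> S} -> V) :
  \sum_v F v = \sum_a \sum_(v : {ffun 'I_n -> S})
    F [ffun i => oapp v a (unlift ord0 i)].
Proof.
rewrite pair_bigA /= (reindex (fun p : S * {ffun 'I_n -> S} =>
  [ffun i => oapp p.2 p.1 (unlift ord0 i)])) //=.
exists (fun v : {ffun 'I_n.+1 -> S} => (v ord0, [ffun i => v (lift ord0 i)])).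
  move=> [a v] _ /=; congr (_, _); first by rewrite ffunE unlift_none.
  by apply/ffunP => i; rewrite !ffunE liftK.
move=> v _; apply/ffunP => i; rewrite ffunE /=.
by case: unliftP => [j ->|->] //=; rewrite ffunE.
Qed.

Definition kernel_op (K : fieldType) (S : finType) (T : S -> S -> K)
    (phi : {ffun S -> K}) : {ffun S -> K} :=
  [ffun nu => \sum_mu T mu nu * phi mu].

(** A matrix product as a sum over paths of states. The induction peels off the bottom state, whose
    sum is one application of [kernel_op]. *)
Lemma path_sum (K : fieldType) (X : Type) (S : finType) (T : X -> S -> S -> K)
    n (x : 'I_n -> X) (phi : {ffun S -> K}) nu :
  \sum_(v : {ffun 'I_n.+1 -> S} | v ord_max == nu)
    phi (v ord0) * \prod_(r < n) T (x r) (v (widen_ord (leqnSn n) r))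
                                    (v (lift ord0 r)) =
  foldl (fun phi y => kernel_op (T y) phi) phi (codom x) nu.
Proof.
elim: n x phi => [|n IH] x phi.
  rewrite big_mkcond big_ffun_ordS /codom /image_mem enum_ord0 /=.
  rewrite (bigD1 nu) //= [X in _ + X]big1 ?addr0 => [|a ne].
    rewrite (big_pred1 [ffun i : 'I_0 => nu]) => [|v].
      by rewrite !ffunE unlift_none /= (_ : ord_max = ord0) ?unlift_none ?eqxx
        ?big_ord0 ?mulr1 //; apply: val_inj.
    by apply/esym/eqP/ffunP => -[].
  rewrite big1 // => v _.
  rewrite (_ : ord_max = ord0); last exact: val_inj.
  by rewrite ffunE unlift_none /= (negPf ne).
have -> : codom x = x ord0 :: codom (x \o lift ord0).
  by rewrite /codom /image_mem enum_ordSl /= -map_comp.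
rewrite /= -IH big_mkcond big_ffun_ordS exchange_big [RHS]big_mkcond.
apply: eq_bigr => v _ /=.
have vmax a : [ffun i => oapp v a (unlift ord0 i)] ord_max = v ord_max.
  rewrite ffunE (_ : ord_max = lift ord0 ord_max) ?liftK //.
  exact: val_inj.
under eq_bigr => a _ do rewrite vmax.
case: ifP => _; last by rewrite big1.
rewrite ffunE mulr_suml; apply: eq_bigr => a _.
rewrite big_ord_recl !ffunE (_ : widen_ord _ ord0 = ord0); last exact: val_inj.
rewrite unlift_none liftK /= mulrA [phi a * _]mulrC; congr (_ * _).
apply: eq_bigr => r _.
rewrite (_ : widen_ord _ (lift ord0 r) = lift ord0 (widen_ord (leqnSn n) r)).
  by rewrite !ffunE !liftK.
exact: val_inj.
Qed.

Section RowTuples.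

Variables (K : fieldType) (N : nat).
Implicit Types (w : nat -> nat -> nat -> nat -> K) (g : nat -> K).

Lemma nth_occ_lt M (t : state M N) c : (0 < N)%N -> (nth 0%N (occ t) c < N)%N.
Proof.
move=> N0; have [lt|le] := ltnP c M; last by rewrite nth_default ?size_occ.
by rewrite (nth_map (Ordinal N0)) ?size_tuple ?ltn_ord.
Qed.

(** [t] lists the left edges of the columns; the default 0 of [nth] past the last one is the empty
    right boundary. For [M = 0] it also forces [j = 0]. *)
Lemma row_pf_tuple w M j bs ts : (0 < N)%N -> size bs = M -> size ts = M ->
  (M = 0 \/ j < N)%N ->
  row_pf N w j bs ts = \sum_(t : state M N | nth 0%N (occ t) 0 == j)
    \prod_(c < M) w (nth 0%N bs c) (nth 0%N (occ t) c)
                    (nth 0%N ts c) (nth 0%N (occ t) c.+1).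
Proof.
move=> N0; elim: M bs ts j => [|M IH] [|i bs] [|k ts] j //=
  => [_ _ _|[sb] [st] [//|ltj]].
  rewrite big_mkcond (big_pred1 [tuple]) => [|t]; last first.
    by apply/esym/eqP/tuple0.
  by rewrite big_ord0 /= eq_sym; case: eqP.
rewrite [RHS]big_mkcond [RHS]big_tuple_cons /= [RHS](bigD1 (Ordinal ltj)) //=.
rewrite [X in _ = _ + X]big1 ?addr0 => [|a ne]; last first.
  rewrite big1 // => t _; case: eqP => // e.
  by case/eqP: ne; apply: val_inj.
rewrite eqxx.
transitivity (\sum_(l < N) \sum_(t : state M N) if nth 0%N (occ t) 0 == l
   then w i j k l * \prod_(c < M) w (nth 0%N bs c) (nth 0%N (occ t) c)
                    (nth 0%N ts c) (nth 0%N (occ t) c.+1) else 0).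
  apply: eq_bigr => l _; rewrite IH //; last by right.
  by rewrite mulr_sumr big_mkcond.
rewrite exchange_big; apply: eq_bigr => t _.
have lt0 : (nth 0%N (occ t) 0 < N)%N by apply: nth_occ_lt.
rewrite -big_mkcond (big_pred1 (Ordinal lt0)) => [|l /=]; last first.
  by rewrite eq_sym.
by rewrite big_ord_recl.
Qed.

Lemma row_kernel_tuple g w M bs ts : (0 < N)%N -> size bs = M -> size ts = M ->
  row_kernel N g w bs ts = \sum_(t : state M N) g (nth 0%N (occ t) 0) *
    \prod_(c < M) w (nth 0%N bs c) (nth 0%N (occ t) c)
                    (nth 0%N ts c) (nth 0%N (occ t) c.+1).
Proof.
move=> N0 sb st; rewrite /row_kernel.
transitivity (\sum_(j < N) \sum_(t : state M N) if nth 0%N (occ t) 0 == j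
   then g j * \prod_(c < M) w (nth 0%N bs c) (nth 0%N (occ t) c)
                    (nth 0%N ts c) (nth 0%N (occ t) c.+1) else 0).
  apply: eq_bigr => j _; rewrite (row_pf_tuple _ N0 sb st); last by right.
  by rewrite mulr_sumr big_mkcond.
rewrite exchange_big; apply: eq_bigr => t _.
have lt0 : (nth 0%N (occ t) 0 < N)%N by apply: nth_occ_lt.
by rewrite -big_mkcond (big_pred1 (Ordinal lt0)) // => j /=; rewrite eq_sym.
Qed.

End RowTuples.

(** [inord] sends values above [N] to 0, so [f] is represented faithfully only if it is bounded by
    [N] and vanishes from [M] on. *)
Definition mk_state M N (f : nat -> nat) : state M N.+1 :=
  [tuple inord (f c) | c < M].

Lemma nth_mk_state M N (f : nat -> nat) : (forall c, (f c <= N)%N) ->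
  (forall c, (M <= c)%N -> f c = 0%N) ->
  forall c, nth 0%N (occ (mk_state M N f)) c = f c.
Proof.
move=> fN fM c; have [lt|le] := ltnP c M; last first.
  by rewrite nth_default ?size_occ ?fM.
rewrite /occ (nth_map ord0) ?size_tuple //.
have -> : nth ord0 (mk_state M N f) c = tnth (mk_state M N f) (Ordinal lt).
  by rewrite (tnth_nth ord0).
by rewrite tnth_mktuple /= inordK // ltnS.
Qed.

(** For the multiplicities of a partition [la] with at most [M] parts this telescopes to
    [part la c]. *)
Definition tail_sum (f : nat -> nat) M c : nat := (\sum_(c <= i < M) f i)%N.

Lemma tail_sum_leq0 f M c : (tail_sum f M c <= tail_sum f M 0)%N.
Proof.
rewrite /tail_sum; have [le|lt] := leqP c M; last by rewrite big_geq // ltnW.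
by rewrite [leqRHS](@big_cat_nat _ _ _ c) //= leq_addl.
Qed.

Lemma leq_tail_sum f M c : (forall c, (M <= c)%N -> f c = 0%N) ->
  (f c <= tail_sum f M c)%N.
Proof.
move=> f0; have [lt|le] := ltnP c M; last by rewrite f0.
by rewrite /tail_sum big_ltn // leq_addr.
Qed.

Lemma tail_sum_widen f M M' c : (forall c, (M <= c)%N -> f c = 0%N) ->
  (M <= M')%N -> tail_sum f M' c = tail_sum f M c.
Proof.
move=> f0 MM'; rewrite /tail_sum; have [le|lt] := leqP c M.
  rewrite (@big_cat_nat _ _ _ M) //= [X in (_ + X)%N]big1_seq ?addn0 // => i /=.
  by rewrite mem_index_iota => /andP[Mi _]; apply: f0.
rewrite [RHS]big_geq ?(ltnW lt) // big1_seq // => i /=.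
rewrite mem_index_iota => /andP[ci _].
by apply: f0; lia.
Qed.

Lemma part_mult_default p M c : (size p <= M)%N -> (M <= c)%N ->
  part_mult p c = 0%N.
Proof.
by move=> pM Mc; rewrite /part_mult /part !nth_default //; lia.
Qed.

Section Expansion.

Variables (K : fieldType) (q s : K) (n : nat).
Implicit Types (la mu : seq nat) (x : 'I_n -> K).

Local Notation W := (vertex_weight q s).
Local Notation lw := (left_weight q s).

Lemma vertex_weight0000 y : W y 0 0 0 0 = 1.
Proof. by rewrite /vertex_weight /xqpoch /qpoch !big_ord0 !mulr1 divr1. Qed.

(* In a configuration of nonzero weight no path moves left or disappears, so
   the number of paths in columns [>= c] is at most that on the top boundary. *)
Lemma config_bounds la mu x M (hv : config n) : (size la <= M)%N ->
  admissible la mu hv -> config_weight q s x hv != 0 ->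
  (forall r c, (hv.1 r c <= tail_sum (part_mult la) M c)%N) /\
  (forall r c, (hv.2 r c <= tail_sum (part_mult la) M c)%N).
Proof.
case: hv => h v /= laM [/= [N1 h0] [N2 v0] _ vla] /prodf_neq0 /= w0.
pose N := maxn M (maxn N1 N2).
have hN r c : (N <= c)%N -> h r c = 0%N by move=> le; apply: h0; lia.
have vN r c : (N <= c)%N -> v r c = 0%N by move=> le; apply: v0; lia.
(* A nonzero weight forces conservation at each vertex; past [N] all edges are empty, so the product
   over columns is finite. *)
have flow (r : 'I_n) c : (v (widen_ord (leqnSn n) r) c + h r c =
    v (lift ord0 r) c + h r c.+1)%N.
  have [lt|le] := ltnP c N; last by rewrite !hN ?vN //; lia.
  have := w0 r isT; rewrite mulf_eq0 => /norP[_].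
  rewrite (@fsprod_nat_ord _ N) => [/prodf_neq0/(_ (Ordinal lt) isT)/=|c' le].
    by apply: contraNeq => ne; apply/eqP; apply: vertex_weight_conserving.
  by rewrite !vN ?hN ?vertex_weight0000 //; lia.
(* Conservation summed over all columns from [c] on: only the edge entering column [c] adds paths
   there. *)
have tail (r : 'I_n) c : (h r c + tail_sum (v (widen_ord (leqnSn n) r)) N c =
    tail_sum (v (lift ord0 r)) N c)%N.
  move: {2}(N - c)%N (erefl (N - c)%N) => k.
  elim: k c => [|k IH] c e.
    by rewrite /tail_sum hN ?big_geq //; lia.
  have := IH c.+1.
  rewrite /tail_sum ![(\sum_(c <= _ < _) _)%N]big_ltn; try by lia.
  by have := flow r c; lia.
have max_tail r c : (tail_sum (v r) N c <= tail_sum (part_mult la) M c)%N.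
  have := @ord_chain_leq n (fun r => tail_sum (v r) N c).
  move=> /(_ _ r) /leq_trans -> //.
    by move=> r'; rewrite -tail leq_addl.
  rewrite -(@tail_sum_widen _ M N); last by lia.
    by rewrite /tail_sum; under eq_bigr do rewrite vla.
  by move=> c'; apply: part_mult_default.
split=> r c.
  by apply: leq_trans (max_tail (lift ord0 r) c); rewrite -tail leq_addr.
by apply: leq_trans (max_tail r c); apply: leq_tail_sum => c'; apply: vN.
Qed.

Definition embed M N
    (hv : {ffun 'I_n -> state M N} * {ffun 'I_n.+1 -> state M N}) : config n :=
  (fun r c => nth 0%N (occ (hv.1 r)) c, fun r c => nth 0%N (occ (hv.2 r)) c).

Lemma occ_nth_inj M N (t t' : state M N) :
  nth 0%N (occ t) =1 nth 0%N (occ t') -> t = t'.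
Proof.
move=> e; apply: val_inj; apply: (inj_map val_inj).
by apply: (@eq_from_nth _ 0%N) => [|c _]; [rewrite !size_occ | apply: e].
Qed.

Lemma embed_inj M N : injective (@embed M N).
Proof.
move=> [h v] [h' v'] [eh ev]; congr (_, _); apply/ffunP => r;
  apply: occ_nth_inj => c.
- exact: (congr1 (fun f => f r c) eh).
- exact: (congr1 (fun f => f r c) ev).
Qed.

Lemma config_weight_embed M N x h v :
  config_weight q s x (@embed M N (h, v)) =
  \prod_(r < n) (lw (x r) (nth 0%N (occ (h r)) 0) * \prod_(c < M)
    W (x r)
      (nth 0%N (occ (v (widen_ord (leqnSn n) r))) c) (nth 0%N (occ (h r)) c)
      (nth 0%N (occ (v (lift ord0 r))) c) (nth 0%N (occ (h r)) c.+1)).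
Proof.
apply: eq_bigr => r _ /=; rewrite (@fsprod_nat_ord _ M) // => c le.
by rewrite !nth_default ?vertex_weight0000 // size_occ // leqW.
Qed.

(** A matrix entry of a product of transfer operators, the bottom row acting first. Occupations
    range below [B.+2], which exceeds the path counts of both boundaries and is at least 2, as the
    commutation relations require. *)
Lemma spin_qWhittakerE la mu x M B : (size la <= M)%N -> (size mu <= M)%N ->
  (tail_sum (part_mult la) M 0 <= B)%N ->
  (tail_sum (part_mult mu) M 0 <= B)%N ->
  spin_qWhittaker q s la mu x =
  foldl (fun phi y => spin_op q s y phi)
    [ffun nu => (nu == mk_state M B.+1 (part_mult mu))%:R] (codom x)
    (mk_state M B.+1 (part_mult la)).
Proof.
move=> laM muM laB muB.
have nth_state p : (size p <= M)%N -> (tail_sum (part_mult p) M 0 <= B)%N ->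
    forall c, nth 0%N (occ (mk_state M B.+1 (part_mult p))) c = part_mult p c.
  move=> pM pB; have p0 c := @part_mult_default p M c pM.
  apply: nth_mk_state => // c; apply: leq_trans (leq_tail_sum c p0) _.
  by apply: leq_trans (tail_sum_leq0 _ _ _) _; apply: leqW.
rewrite /spin_qWhittaker (fsbig_fin_inj (@embed_inj M B.+2)); last first.
  move=> hv adm w0; have [hb vb] := config_bounds laM adm w0.
  have bnd c : (tail_sum (part_mult la) M c <= B.+1)%N.
    by apply: leq_trans (tail_sum_leq0 _ _ _) _; apply: leqW.
  have tM c : (M <= c)%N -> tail_sum (part_mult la) M c = 0%N.
    by move=> le; rewrite /tail_sum big_geq.
  exists ([ffun r => mk_state M B.+1 (hv.1 r)],
          [ffun r => mk_state M B.+1 (hv.2 r)]).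
  rewrite [hv]surjective_pairing; congr (_, _);
    apply/funext => r; apply/funext => c; rewrite ffunE nth_mk_state //.
  - by move=> c'; apply: leq_trans (hb _ _) (bnd _).
  - by move=> c' /tM e; have := hb r c'; rewrite e leqn0 => /eqP.
  - by move=> c'; apply: leq_trans (vb _ _) (bnd _).
  - by move=> c' /tM e; have := vb r c'; rewrite e leqn0 => /eqP.
pose T y (mu nu : state M B.+2) := if (sumn (occ nu) < B.+2)%N
  then row_kernel B.+2 (lw y) (W y) (occ mu) (occ nu) else 0.
have -> : (fun phi y => spin_op q s y phi) = (fun phi y => kernel_op (T y) phi).
  apply/funext => phi; apply/funext => y; apply/ffunP => nu; rewrite !ffunE /T.
  by case: ifP => // _; rewrite big1 // => m _; rewrite mul0r.
rewrite -path_sum big_mkcond.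
transitivity (\sum_(v : {ffun 'I_n.+1 -> state M B.+2})
    \sum_(h : {ffun 'I_n -> state M B.+2})
    if (v ord0 == mk_state M B.+1 (part_mult mu)) &&
       (v ord_max == mk_state M B.+1 (part_mult la))
    then config_weight q s x (embed (h, v)) else 0).
  rewrite exchange_big pair_bigA; apply: eq_bigr => -[h v] _ /=.
  congr (if _ then _ else _).
  apply/asboolP/andP => [[_ _ v0 vm]|[/eqP v0 /eqP vm]].
    split; apply/eqP/occ_nth_inj => c.
      by rewrite nth_state //; apply: v0.
    by rewrite nth_state //; apply: vm.
  split.
  - by exists M => r c le; rewrite /= nth_default ?size_occ.
  - by exists M => r c le; rewrite /= nth_default ?size_occ.
  - by move=> c; rewrite /= v0 nth_state.
  - by move=> c; rewrite /= vm nth_state.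
rewrite [RHS]big_mkcond; apply: eq_bigr => v _; rewrite ffunE.
case: eqP => _ /=; last by rewrite big1 // mul0r if_same.
case: eqP => [vm|_]; last by rewrite big1.
rewrite mul1r; transitivity (\prod_(r < n) row_kernel B.+2 (lw (x r)) (W (x r))
    (occ (v (widen_ord (leqnSn n) r))) (occ (v (lift ord0 r)))).
  (* For fixed vertical edges the rows are independent, so the sum over horizontal edges
     factorises. *)
  under eq_bigr => h _ do rewrite config_weight_embed.
  rewrite -(bigA_distr_bigA (fun r (t : state M B.+2) =>
    lw (x r) (nth 0%N (occ t) 0) * \prod_(c < M)
    W (x r) (nth 0%N (occ (v (widen_ord (leqnSn n) r))) c) (nth 0%N (occ t) c)
            (nth 0%N (occ (v (lift ord0 r))) c) (nth 0%N (occ t) c.+1))).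
  by apply: eq_bigr => r _; rewrite -row_kernel_tuple // size_occ.
(* If the product is nonzero, path counts increase from row to row, so the bound at the top makes
   every cut-off in [T] inactive. *)
set p := (LHS); have [p0|/prodf_neq0 pn0] := eqVneq p 0.
  have /prodf_eq0[r _ /eqP r0] : p == 0 by rewrite p0.
  by rewrite p0 (bigD1 r) //= /T r0 if_same mul0r.
apply: eq_bigr => r _; rewrite /T ifT //.
apply: leq_ltn_trans (_ : sumn (occ (v ord_max)) < B.+2)%N.
  apply: (ord_chain_leq (f := fun r => sumn (occ (v r)))) => r'.
  rewrite leqNgt; apply: contra (pn0 r' isT) => lt.
  by rewrite row_kernel_eq0 //; apply: vertex_weight_conserving.
rewrite vm ltnS; apply: leqW; apply: leq_trans (laB).
rewrite sumnE (big_nth 0%N) size_occ /tail_sum.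
by rewrite (eq_bigr (part_mult la)) ?leqnn // => c _; apply: nth_state.
Qed.

End Expansion.

(** Permuting the variables permutes a list of commuting operators; the state space and both
    boundary states do not depend on the variables. *)
Lemma spin_qWhittaker_sym (K : numFieldType) (q s : K) n la mu :
  `|q| < 1 -> `|s| < 1 ->
  symmetric_fun (fun x : 'I_n -> K => spin_qWhittaker q s la mu x).
Proof.
move=> q1 s1 sigma x.
set M := maxn (size la) (size mu).
set B := maxn (tail_sum (part_mult la) M 0) (tail_sum (part_mult mu) M 0).
rewrite !(@spin_qWhittakerE _ q s n la mu _ M B) ?leq_maxl ?leq_maxr //.
congr (fun_of_fin _ _); apply: foldl_perm => [phi y z|].
  exact: spin_op_comm.
rewrite (_ : codom (fun i => x (sigma i)) = map x (codom sigma)); last first.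
  by rewrite /codom /image_mem -[RHS]map_comp; apply: eq_map.
have /(perm_map x) : perm_eq (codom sigma) (enum 'I_n); last exact.
apply: uniq_perm; first by rewrite map_inj_uniq ?enum_uniq //; apply: perm_inj.
  exact: enum_uniq.
by move=> i; rewrite mem_enum -{1}(permKV sigma i) codom_f.
Qed.

Theorem corollary5p8 (R : realType) (q s : R[i])
    (hq : `|q| < 1) (hs : `|s| < 1) (n : nat) (hn : (0 < n)%N)
    (la mu : seq nat) (hla : is_partition la) (hmu : is_partition mu)
    (hlamu : part_contains la mu) :
  symmetric_fun (fun x : 'I_n -> R[i] => spin_qWhittaker q s la mu x) /\
  symmetric_fun (fun x : 'I_n -> R[i] => dual_spin_qWhittaker q s la mu x).
Proof.
have sym := @spin_qWhittaker_sym _ q s n la mu hq hs.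
by split=> // sigma x; rewrite /dual_spin_qWhittaker sym.
Qed.
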